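(* Let $d\ge 2$, $H=\{x\in\mathbb{R}^d: x([d])=0\}$ and $P=\operatorname{conv}\{\pm(e_i-e_j):1\le i<j\le d\}\subset H$. For generic points $a,b\in H$, the bisectors $\operatorname{bis}^P(0,a)$ and $\operatorname{bis}^P(0,b)$ with respect to the discrete Wasserstein distance are equivalent if and only if $D(a)=D(b)$.
   Context: $[d]=\{1,\dots,d\}$, $x(K)=\sum_{i\in K}x_i$. The discrete Wasserstein distance on $H$ is $\operatorname{dist}^P(a,b)=\min\{\alpha\ge0:b-a\in\alpha P\}$, where $P$ is full-dimensional in $H$. The bisector is $\operatorname{bis}^P(a,b)=\{x\in H:\operatorname{dist}^P(a,x)=\operatorname{dist}^P(b,x)\}$. The facets of $P$ are $F_I=\operatorname{conv}\{e_i-e_j:i\in I,\ j\notin I\}$ for $\emptyset\ne I\subsetneq[d]$, with facet cones $C_I=\operatorname{cone}(F_I)=\{x\in H: x_i\ge0\ \forall i\in I,\ x_i\le0\ \forall i\notin I\}$. Set $\operatorname{bis}_{I,J}(0,a)=\operatorname{bis}^P(0,a)\cap C_I\cap(C_J+a)$. Bisectors $\operatorname{bis}^P(0,a)$, $\operatorname{bis}^P(0,b)$ are equivalent if for all $\emptyset\neq I,J\subsetneq[d]$: $\operatorname{bis}_{I,J}(0,a)\neq\emptyset\Leftrightarrow\operatorname{bis}_{I,J}(0,b)\neq\emptyset$. For $a\in H$ define $I_a^+=\{i:a_i>0\}$, $I_a^-=\{i:a_i<0\}$, $S_a^+=\{K\subset[d]:a(K)>0\}$, $S_a^-=\{K\subset[d]:a(K)<0\}$,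 and for $\epsilon\in\{+,-\}$: $I_{a,<}^{\epsilon}=\{X\subseteq I_a^{\epsilon}:a(X)<a(I_a^{\epsilon}\setminus X)\}$ and $I_{a,>}^{\epsilon}=\{X\subseteq I_a^{\epsilon}:a(X)>a(I_a^{\epsilon}\setminus X)\}$. A point $a\in H$ is generic if $S_a^+\sqcup S_a^-=2^{[d]}\setminus\{\emptyset,[d]\}$, $I_{a,>}^+\sqcup I_{a,<}^+=2^{I_a^+}$ and $I_{a,>}^-\sqcup I_{a,<}^-=2^{I_a^-}$. Finally $D(a)=(S_a^+,\,I_{a,>}^+,\,I_{a,<}^-)$. *)

(* Defs.v *)
From HB Require Import structures.
From mathcomp Require Import all_boot all_order all_algebra.
From mathcomp Require Import all_classical all_reals.

Set Implicit Arguments.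
Unset Strict Implicit.
Unset Printing Implicit Defensive.

Import Order.TTheory GRing.Theory Num.Theory.

Local Open Scope classical_set_scope.
Local Open Scope ring_scope.

(* Points of R^d are row vectors 'rV[R]_d, and the index set [d] is 'I_d.
   Subsets of R^d are classical sets ([set _]); subsets of [d] and families of
   such subsets are finite sets ([{set 'I_d}], [{set {set 'I_d}}]). *)

Section Convex.
Context {R : realType} {d : nat}.
Implicit Types (A : set 'rV[R]_d).

Definition conv A : set 'rV[R]_d :=
  [set x | exists (n : nat) (w : 'I_n -> R) (v : 'I_n -> 'rV[R]_d),
    [/\ forall k, 0 <= w k, \sum_k w k = 1, forall k, A (v k) &
        x = \sum_k w k *: v k]].

(* n = 0 is allowed, so 0 always belongs to the cone. *)
Definition cone A : set 'rV[R]_d :=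
  [set x | exists (n : nat) (w : 'I_n -> R) (v : 'I_n -> 'rV[R]_d),
    [/\ forall k, 0 <= w k, forall k, A (v k) & x = \sum_k w k *: v k]].

Definition dilate (alpha : R) A : set 'rV[R]_d := [set alpha *: p | p in A].

Definition translate A (a : 'rV[R]_d) : set 'rV[R]_d := [set p + a | p in A].

End Convex.

Section Wasserstein.
Context {R : realType} {d : nat}.
Implicit Types (a b x : 'rV[R]_d) (I J K X : {set 'I_d}).

Definition unitv (i : 'I_d) : 'rV[R]_d := delta_mx 0 i.

Definition coord_sum x K : R := \sum_(i in K) x 0 i.

Definition H : set 'rV[R]_d := [set x | coord_sum x [set: 'I_d]%SET = 0].

Definition P : set 'rV[R]_d :=
  conv [set v | exists i j : 'I_d, (i < j)%N /\
    (v = unitv i - unitv j \/ v = - (unitv i - unitv j))].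

(* For a, b in H the set below is nonempty and has a minimum, because P is a
   compact polytope with 0 in its interior relative to H; hence inf is min. *)
Definition dist a b : R :=
  inf [set alpha : R | 0 <= alpha /\ dilate alpha P (b - a)].

Definition bis a b : set 'rV[R]_d := [set x | H x /\ dist a x = dist b x].

Definition facet I : set 'rV[R]_d :=
  conv [set v | exists i j : 'I_d,
    [/\ i \in I, j \notin I & v = unitv i - unitv j]].

Definition facet_cone I : set 'rV[R]_d := cone (facet I).

Definition bis_cell I J a : set 'rV[R]_d :=
  bis 0 a `&` facet_cone I `&` translate (facet_cone J) a.

Definition nonempty_proper I : Prop :=
  I <> finset.set0 /\ I <> [set: 'I_d]%SET.

(* Equivalence of the bisectors bis 0 a and bis 0 b. *)
Definition bis_equiv a b : Prop :=
  forall I J, nonempty_proper I -> nonempty_proper J ->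
    (bis_cell I J a !=set0 <-> bis_cell I J b !=set0).

Definition Ipos a : {set 'I_d} := [set i | 0 < a 0 i]%SET.
Definition Ineg a : {set 'I_d} := [set i | a 0 i < 0]%SET.

Definition Spos a : {set {set 'I_d}} :=
  [set K : {set 'I_d} | 0 < coord_sum a K]%SET.
Definition Sneg a : {set {set 'I_d}} :=
  [set K : {set 'I_d} | coord_sum a K < 0]%SET.

(* [lt_half a K] and [gt_half a K], for K = I_a^+ or I_a^-, are the families
   I_{a,<}^{+/-} and I_{a,>}^{+/-}. *)
Definition lt_half a K : {set {set 'I_d}} :=
  [set X : {set 'I_d} | (X \subset K) &&
     (coord_sum a X < coord_sum a (K :\: X)%SET)]%SET.
Definition gt_half a K : {set {set 'I_d}} :=
  [set X : {set 'I_d} | (X \subset K) &&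
     (coord_sum a X > coord_sum a (K :\: X)%SET)]%SET.

Definition disjoint_union (A B C : {set {set 'I_d}}) : Prop :=
  (A :|: B)%SET = C /\ (A :&: B)%SET = finset.set0.

Definition generic a : Prop :=
  [/\ disjoint_union (Spos a) (Sneg a)
        (powerset [set: 'I_d]%SET :\: [set finset.set0; [set: 'I_d]])%SET,
      disjoint_union (gt_half a (Ipos a)) (lt_half a (Ipos a))
        (powerset (Ipos a)) &
      disjoint_union (gt_half a (Ineg a)) (lt_half a (Ineg a))
        (powerset (Ineg a))].

Definition D a : {set {set 'I_d}} * {set {set 'I_d}} * {set {set 'I_d}} :=
  (Spos a, gt_half a (Ipos a), lt_half a (Ineg a)).

End Wasserstein.

(* Main.v *)
Require Import Defs.
From mathcomp Require Import all_boot all_order all_algebra.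
From mathcomp Require Import all_classical all_reals.
From mathcomp Require Import ring lra.

Import Order.TTheory GRing.Theory Num.Theory.

Local Open Scope ring_scope.

(** The distance [dist x y] is the positive mass of [y - x], so the cell
    [bis_cell I J a] is the solution set of a linear system whose only coupling is
    through the total masses on the four blocks [I :&: J], [I :\: J], [J :\: I] and
    [~: (I :|: J)].  On the first and last blocks the coordinates are bounded on
    one side only, on the other two they lie between [0] and [a].
    Eliminating the masses gives the criterion [cell_cond], which mentions [a] only through [D a]; this is one implication.
    For the other, [Spos a] is recovered by exhibiting, for each [I] with
    [0 < coord_sum a I], a partner [J] of a nonempty cell ([Ineg a] up to one
    element), and the half-families are recovered from the cells [(X, Ineg a)] and
    [(Ipos a, X)]. *)

(** * Sums of coordinates over index sets *)

Section CoordSum.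
Context {R : realType} {d : nat}.
Implicit Types (x y : 'rV[R]_d) (K L : {set 'I_d}).

Lemma coord_sumD x y K : coord_sum (x + y) K = coord_sum x K + coord_sum y K.
Proof. by rewrite -big_split; apply: eq_bigr => i _; rewrite mxE. Qed.

Lemma coord_sumN x K : coord_sum (- x) K = - coord_sum x K.
Proof. by rewrite -sumrN; apply: eq_bigr => i _; rewrite mxE. Qed.

Lemma coord_sumZ c x K : coord_sum (c *: x) K = c * coord_sum x K.
Proof. by rewrite mulr_sumr; apply: eq_bigr => i _; rewrite mxE. Qed.

Lemma coord_sum_comb (T : finType) (w : T -> R) (v : T -> 'rV[R]_d) K :
  coord_sum (\sum_t w t *: v t) K = \sum_t w t * coord_sum (v t) K.
Proof.
rewrite /coord_sum; under eq_bigr do rewrite summxE.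
rewrite exchange_big; apply: eq_bigr => t _.
by rewrite mulr_sumr; apply: eq_bigr => i _; rewrite mxE.
Qed.

Lemma coord_sum_unitv (i : 'I_d) K : coord_sum (unitv i : 'rV[R]_d) K = (i \in K)%:R.
Proof.
rewrite /coord_sum /unitv; under eq_bigr do rewrite mxE eqxx /= .
case: (boolP (i \in K)) => iK.
  rewrite (bigD1 i) //= eqxx big1 ?addr0 // => j /andP[_ /negbTE ji].
  by rewrite ji.
by rewrite big1 // => j jK; case: eqP => // ji; rewrite -ji jK in iK.
Qed.

Lemma coord_sum_set0 x : coord_sum x finset.set0 = 0.
Proof. exact: big_set0. Qed.

Lemma coord_sumDset x K L : K \subset L ->
  coord_sum x (L :\: K)%SET = coord_sum x L - coord_sum x K.
Proof.
move=> /finset.setIidPr KL; rewrite /coord_sum [in RHS](big_setID K) /= KL.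
by rewrite addrAC subrr add0r.
Qed.

Lemma coord_sumC x K : H x -> coord_sum x (~: K)%SET = - coord_sum x K.
Proof.
by move=> Hx; rewrite -finset.setTD coord_sumDset ?finset.subsetT // [X in X - _]Hx sub0r.
Qed.

Lemma H_sub {x y} : H x -> H y -> H (x - y).
Proof. by rewrite /H /= coord_sumD coord_sumN => -> ->; rewrite subr0. Qed.

(** Stated for an arbitrary [f] so that it serves the point [x], the vector [a], and the positive
    and negative parts of [a] alike. *)
Lemma quad_split (f : 'I_d -> R) (I J : {set 'I_d}) :
  [/\ \sum_(i in I) f i = \sum_(i in I :&: J) f i + \sum_(i in I :\: J) f i,
      \sum_(i in J) f i = \sum_(i in I :&: J) f i + \sum_(i in J :\: I) f i &
      \sum_(i in [set: 'I_d]%SET) f i =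
        \sum_(i in I :&: J) f i + \sum_(i in I :\: J) f i +
        \sum_(i in J :\: I) f i + \sum_(i in ~: (I :|: J)) f i].
Proof.
have eI : \sum_(i in I) f i =
    \sum_(i in I :&: J) f i + \sum_(i in I :\: J) f i.
  by rewrite (big_setID J).
split=> //; first by rewrite (big_setID I) /= finset.setIC.
rewrite -eI (big_setID I) /= finset.setTI -addrA; congr (_ + _).
rewrite finset.setTD (big_setID J) /= finset.setIC -finset.setDE.
by congr (_ + _); apply: eq_bigl => i; rewrite !inE negb_or andbC.
Qed.

End CoordSum.

(** * Convex combinations, the distance and the facet cones *)

Section Distance.
Context {R : realType} {d : nat}.
Implicit Types (x y : 'rV[R]_d) (I K : {set 'I_d}).

(** Points of weight zero need not lie in [A]: they are replaced by one point of nonzero weight,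
    which exists because the weights sum to 1. The product coupling below needs this freedom, as
    well as an index type of pairs. *)
Lemma conv_fin (A : set 'rV[R]_d) (T : finType) (w : T -> R) (v : T -> 'rV[R]_d) :
  (forall t, 0 <= w t) -> \sum_t w t = 1 -> (forall t, w t != 0 -> A (v t)) ->
  conv A (\sum_t w t *: v t).
Proof.
move=> w0 w1 Av.
have [t0 wt0] : exists t0, w t0 != 0.
  apply/existsP; apply: contraT; rewrite negb_exists => /forallP wz.
  move: w1; rewrite big1 => [/esym/eqP|t _]; first by rewrite oner_eq0.
  by apply/eqP; rewrite -[_ == _]negbK.
pose v' t := if w t == 0 then v t0 else v t.
exists #|T|, (fun k => w (enum_val k)), (fun k => v' (enum_val k)).
split=> [k||k|] //.
- by rewrite -w1 [RHS](reindex _ (onW_bij _ (enum_val_bij T))).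
- by rewrite /v'; case: eqP => [_|/eqP]; apply: Av.
- rewrite [LHS](reindex _ (onW_bij _ (enum_val_bij T))) /=.
  apply: eq_bigr => k _; rewrite /v'.
  by case: eqP => [->|_] //; rewrite !scale0r.
Qed.

Lemma sum_maxr0 x : \sum_i Num.max (x 0 i) 0 = coord_sum x (Ipos x).
Proof.
rewrite /coord_sum [RHS]big_mkcond /=; apply: eq_bigr => i _.
by rewrite inE maxEgt; case: ltgtP.
Qed.

Lemma sum_maxN0 x : H x -> \sum_i Num.max (- x 0 i) 0 = coord_sum x (Ipos x).
Proof.
move=> Hx; rewrite -sum_maxr0; apply/esym/eqP; rewrite -subr_eq0 -sumrB.
rewrite -[X in _ == X]Hx; apply/eqP; apply: eq_big => [i|i _]; first by rewrite inE.
by rewrite !maxEge oppr_ge0; case: (ltgtP (x 0 i) 0) => ?; lra.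
Qed.

Lemma coord_sum_Ipos_ge0 x : 0 <= coord_sum x (Ipos x).
Proof. by apply: sumr_ge0 => i; rewrite inE => /ltW. Qed.

Lemma coord_sum_Ipos_eq0 x : H x -> coord_sum x (Ipos x) = 0 -> x = 0.
Proof.
move=> Hx N0; apply/rowP => i; rewrite mxE.
have := sum_maxr0 x; rewrite N0 => /psumr_eq0P p0.
have := sum_maxN0 x Hx; rewrite N0 => /psumr_eq0P n0.
have {p0} : Num.max (x 0 i) 0 = 0.
  by apply: p0 => // j _; rewrite le_max lexx orbT.
have {n0} : Num.max (- x 0 i) 0 = 0.
  by apply: n0 => // j _; rewrite le_max lexx orbT.
by rewrite !maxEge oppr_ge0; case: (ltgtP (x 0 i) 0) => ?; lra.
Qed.

(* The product coupling of the normalised positive and negative parts of [x]. *)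
Lemma conv_transport (A : set 'rV[R]_d) x :
  H x -> 0 < coord_sum x (Ipos x) ->
  (forall i j, 0 < x 0 i -> x 0 j < 0 -> A (unitv i - unitv j)) ->
  exists2 q, conv A q & x = coord_sum x (Ipos x) *: q.
Proof.
move=> Hx N0 Ax; set N := coord_sum x _ in N0 *.
pose p i := Num.max (x 0 i) 0; pose n i : R := Num.max (- x 0 i) 0.
(* Both parts of [x] have mass [N], so dividing by [N ^+ 2] makes the weights sum to 1, while
   [N * w] has marginals [p] and [n]. *)
pose w (t : 'I_d * 'I_d) : R := p t.1 * n t.2 / N ^+ 2.
pose v (t : 'I_d * 'I_d) : 'rV[R]_d := unitv t.1 - unitv t.2.
have p0 i : 0 <= p i by rewrite le_max lexx orbT.
have n0 i : 0 <= n i by rewrite le_max lexx orbT.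
have sp : \sum_i p i = N by exact: sum_maxr0.
have sn : \sum_i n i = N by exact: sum_maxN0.
have Nn0 : N != 0 by rewrite gt_eqF.
exists (\sum_t w t *: v t).
  apply: conv_fin => [t||[i j]].
  - by rewrite divr_ge0 ?mulr_ge0 ?sqr_ge0 ?(ltW N0).
  - rewrite -mulr_suml -(pair_bigA _ (fun i j => p i * n j)) /=.
    under eq_bigr do rewrite -mulr_sumr sn.
    by rewrite -mulr_suml sp -expr2 divff ?expf_neq0.
  - rewrite /w /v /= => wn0; apply: Ax; rewrite ltNge; apply: contra_neqN wn0 => h.
    + by rewrite /p max_r // !mul0r.
    + by rewrite /n max_r ?oppr_le0 // mulr0 mul0r.
rewrite scaler_sumr -(pair_bigA _ (fun i j => N *: (w (i, j) *: v (i, j)))) /=.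
have -> : x = \sum_i p i *: unitv i - \sum_j n j *: unitv j.
  rewrite -sumrB [LHS]row_sum_delta; apply: eq_bigr => i _.
  rewrite -scalerBl; congr (_ *: _); rewrite /p /n !maxEge oppr_ge0.
  by case: (ltgtP (x 0 i) 0) => ?; lra.
have -> : \sum_i p i *: unitv i = \sum_i \sum_j (p i * n j / N) *: unitv i :> 'rV[R]_d.
  apply: eq_bigr => i _; rewrite -scaler_suml -mulr_suml -mulr_sumr sn.
  by rewrite mulfK.
have -> : \sum_j n j *: unitv j = \sum_i \sum_j (p i * n j / N) *: unitv j :> 'rV[R]_d.
  rewrite exchange_big; apply: eq_bigr => j _.
  by rewrite -scaler_suml -!mulr_suml sp mulrAC divff // mul1r.
rewrite -sumrB; apply: eq_bigr => i _; rewrite -sumrB; apply: eq_bigr => j _.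
rewrite scalerA scalerBr; congr (_ *: _ - _ *: _); rewrite /w /=.
all: by field.
Qed.

(** A vertex of [P] has coordinate sum -1, 0 or 1 over [K], and the bound 1 passes to convex
    combinations. With [K] the positive support this is the lower bound on the distance. *)
Lemma coord_sum_dilateP x (alpha : R) K :
  0 <= alpha -> dilate alpha P x -> coord_sum x K <= alpha.
Proof.
move=> a0 [_ [n [w [v [w0 w1 Av ->]]]] <-].
rewrite coord_sumZ coord_sum_comb -[leRHS]mulr1 ler_wpM2l // -w1.
apply: ler_sum => k _; rewrite -[leRHS]mulr1 ler_wpM2l //.
case: (Av k) => i [j [_ [->|->]]];
  rewrite ?coord_sumN coord_sumD coord_sumN !coord_sum_unitv;
  by case: (i \in K); case: (j \in K); rewrite ?mulr1n ?mulr0n; lra.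
Qed.

(** The coupling shows that the positive mass of [y - x] is an admissible dilation factor, and
    [coord_sum_dilateP] shows that no smaller one is. *)
Lemma dist_coord_sum x y (hd : (2 <= d)%N) : H (y - x) ->
  dist x y = coord_sum (y - x) (Ipos (y - x)).
Proof.
move=> Hz; rewrite /dist; set z := y - x in Hz *; set N := coord_sum _ _.
set S := (X in inf X).
have SN : S N.
  split; first exact: coord_sum_Ipos_ge0.
  have [N0|Nn0] := eqVneq N 0.
    (* The factor 0 still needs some point of [P] to dilate; two distinct indices provide a
       vertex. *)
    pose i : 'I_d := Ordinal (ltnW hd); pose j : 'I_d := Ordinal hd.
    exists (unitv i - unitv j).
      exists 1%N, (fun=> 1), (fun=> unitv i - unitv j).
      by split; rewrite ?big_ord1 ?scale1r // => _; exists i, j; split => //; left.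
    by rewrite N0 scale0r; apply/esym; exact: coord_sum_Ipos_eq0.
  have [||q Pq ->] := @conv_transport
     (fun v => exists i j : 'I_d, (i < j)%N /\
    (v = unitv i - unitv j \/ v = - (unitv i - unitv j))) z Hz.
  - by rewrite lt_def Nn0 coord_sum_Ipos_ge0.
  - move=> i j xi xj; case: (ltngtP i j) => ij.
    + by exists i, j; split => //; left.
    + by exists j, i; split => //; right; rewrite opprB.
    + by move: xj; rewrite -(ord_inj ij) => /(lt_trans xi); rewrite ltxx.
  - by exists q.
have lbN : lbound S N by move=> al [al0]; exact: coord_sum_dilateP.
apply/eqP; rewrite eq_le; apply/andP; split.
  by apply: ge_inf => //; exists N.
by apply: lb_le_inf => //; exists N.
Qed.

(** For the converse, the coupling only pairs an index of positive coordinate with one of negative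
    coordinate; the sign conditions put the first in [I] and the second outside, so only vertices of
    the facet occur. *)
Lemma facet_coneP I x : facet_cone I x <->
  [/\ H x, forall i, i \in I -> 0 <= x 0 i & forall i, i \notin I -> x 0 i <= 0].
Proof.
split.
  have vert (v : 'rV[R]_d) : facet I v -> 
    [/\ H v, forall i, i \in I -> 0 <= v 0 i & forall i, i \notin I -> v 0 i <= 0].
    move=> [n [w [u [w0 _ Au ->]]]]; split.
    - rewrite /H /= coord_sum_comb big1 // => k _.
      have [i [j [_ _ ->]]] := Au k.
      by rewrite coord_sumD coord_sumN !coord_sum_unitv !inE subrr mulr0.
    - move=> l lI; rewrite summxE sumr_ge0 // => k _; rewrite mxE mulr_ge0 //.
      have [i [j [_ jI ->]]] := Au k; rewrite !mxE eqxx /=.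
      have /negbTE -> : l != j by apply: contraNneq jI => <-.
      by rewrite subr0 ler0n.
    - move=> l lI; rewrite summxE sumr_le0 // => k _; rewrite mxE mulr_ge0_le0 //.
      have [i [j [iI _ ->]]] := Au k; rewrite !mxE eqxx /=.
      have /negbTE -> : l != i by apply: contraNneq lI => ->.
      by rewrite sub0r oppr_le0 ler0n.
  move=> [n [w [v [w0 Av ->]]]]; split.
  - rewrite /H /= coord_sum_comb big1 // => k _.
    by have [-> _ _] := vert _ (Av k); rewrite mulr0.
  - move=> l lI; rewrite summxE sumr_ge0 // => k _; rewrite mxE mulr_ge0 //.
    by have [_ + _] := vert _ (Av k); apply.
  - move=> l lI; rewrite summxE sumr_le0 // => k _; rewrite mxE mulr_ge0_le0 //.
    by have [_ _] := vert _ (Av k); apply.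
move=> [Hx xI xC]; have [N0|Nn0] := eqVneq (coord_sum x (Ipos x)) 0.
  (* Zero positive mass means [x = 0], the empty combination. *)
  exists 0%N, (fun=> 0), (fun=> 0).
  by split; rewrite ?big_ord0 //; [case | exact: coord_sum_Ipos_eq0].
have [||q Fq xq] := @conv_transport (fun v => exists i j : 'I_d,
    [/\ i \in I, j \notin I & v = unitv i - unitv j]) x Hx.
- by rewrite lt_def Nn0 coord_sum_Ipos_ge0.
- move=> i j xi xj; exists i, j; split => //.
  + by apply: contraTT xi => /xC; rewrite leNgt.
  + by apply: contraTN xj => /xI; rewrite leNgt.
exists 1%N, (fun=> coord_sum x (Ipos x)), (fun=> q).
by split; rewrite ?big_ord1 // => _; exact: coord_sum_Ipos_ge0.
Qed.

Lemma coord_sum_Ipos_cone {I x} : (forall i, i \in I -> 0 <= x 0 i) ->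
  (forall i, i \notin I -> x 0 i <= 0) -> coord_sum x (Ipos x) = coord_sum x I.
Proof.
move=> xI xC; rewrite /coord_sum big_mkcond [RHS]big_mkcond /=.
apply: eq_bigr => i _; rewrite inE; case: (boolP (i \in I)) => iI.
  by have := xI i iI; case: ltgtP.
by have := xC i iI; case: ltgtP.
Qed.

(** On a facet cone the positive mass is the coordinate sum over the index set of the facet. Inside
    a cell both distances are therefore linear, and the bisector becomes one linear equation. *)
Lemma bis_cellP (hd : (2 <= d)%N) (I J : {set 'I_d}) (a : 'rV[R]_d) : H a ->
  (bis_cell I J a !=set0)%classic <->
  exists x : 'rV[R]_d,
    [/\ H x, (forall i, i \in I -> 0 <= x 0 i), (forall i, i \notin I -> x 0 i <= 0),
      (forall i, i \in J -> a 0 i <= x 0 i) & (forall i, i \notin J -> x 0 i <= a 0 i)]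
    /\ coord_sum x I = coord_sum x J - coord_sum a J.
Proof.
move=> Ha; split.
  move=> [x [[[Hx dx] /facet_coneP[_ xI xC]] [y /facet_coneP[Hy yJ yC] yx]]].
  have yE : y = x - a by rewrite -yx addrK.
  move: Hy yJ yC dx; rewrite {}yE {yx y} => Hy yJ yC.
  rewrite !dist_coord_sum // ?subr0 // (coord_sum_Ipos_cone xI) //.
  rewrite (coord_sum_Ipos_cone yJ) // coord_sumD coord_sumN => dx.
  exists x; split => //; split=> // i iJ.
    by have := yJ i iJ; rewrite !mxE subr_ge0.
  by have := yC i iJ; rewrite !mxE subr_le0.
move=> [x [[Hx xI xC xJ xD] e]].
have Hy := H_sub Hx Ha.
have yJ i : i \in J -> 0 <= (x - a) 0 i by move/xJ; rewrite !mxE subr_ge0.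
have yC i : i \notin J -> (x - a) 0 i <= 0 by move/xD; rewrite !mxE subr_le0.
exists x; split; [split; [split|]|] => //.
- rewrite !dist_coord_sum // ?subr0 // (coord_sum_Ipos_cone xI) //.
  by rewrite (coord_sum_Ipos_cone yJ) // coord_sumD coord_sumN.
- exact/facet_coneP.
- by exists (x - a); [exact/facet_coneP | exact: subrK].
Qed.

End Distance.

(** * Positive and negative masses, and consequences of genericity *)

Section Cells.
Context {R : realType} {d : nat}.
Implicit Types (a b x : 'rV[R]_d) (I J K X : {set 'I_d}).

(** In a cell the coordinates in [I :&: J] are at least [Num.max (a 0 i) 0] and those outside
    [I :|: J] at most [Num.min (a 0 i) 0]; these sums are the resulting extreme block masses. *)
Local Notation pos_sum a K := (\sum_(i in K) Num.max (a 0 i) 0).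
Local Notation neg_sum a K := (\sum_(i in K) Num.min (a 0 i) 0).

Lemma pos_neg_sum a K : coord_sum a K = pos_sum a K + neg_sum a K.
Proof. by rewrite -big_split; apply: eq_bigr => i _; rewrite /= addr_max_min addr0. Qed.

Lemma sub_Ipos_sum {a K} : K \subset Ipos a ->
  pos_sum a K = coord_sum a K /\ neg_sum a K = 0.
Proof.
move=> /fintype.subsetP sK; split.
  by apply: eq_bigr => i /sK; rewrite inE => /ltW ?; rewrite max_l.
by apply: big1 => i /sK; rewrite inE => /ltW ?; rewrite min_r.
Qed.

Lemma sub_Ineg_sum {a K} : K \subset Ineg a ->
  pos_sum a K = 0 /\ neg_sum a K = coord_sum a K.
Proof.
move=> /fintype.subsetP sK; split.
  by apply: big1 => i /sK; rewrite inE => /ltW ?; rewrite max_r.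
by apply: eq_bigr => i /sK; rewrite inE => /ltW ?; rewrite min_l.
Qed.

Lemma pos_sumT a : pos_sum a [set: 'I_d]%SET = coord_sum a (Ipos a).
Proof. by rewrite -sum_maxr0; apply: eq_bigl => i; rewrite inE. Qed.

Lemma neg_sumT a : H a -> neg_sum a [set: 'I_d]%SET = - coord_sum a (Ipos a).
Proof.
by move=> Ha; apply/eqP; rewrite -addr_eq0 addrC -pos_sumT -pos_neg_sum Ha.
Qed.

Lemma coord_sum_Ineg a : H a -> coord_sum a (Ineg a) = - coord_sum a (Ipos a).
Proof.
move=> Ha; rewrite -neg_sumT // /coord_sum big_mkcond [RHS]big_mkcond /=.
by apply: eq_bigr => i _; rewrite !inE minElt.
Qed.

Lemma sub_Ipos_gt0 a K i : K \subset Ipos a -> i \in K -> 0 < coord_sum a K.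
Proof.
move=> /fintype.subsetP sK iK; rewrite /coord_sum (bigD1 i) //= ltr_wpDr //.
  by apply: sumr_ge0 => j /andP[/sK + _]; rewrite inE => /ltW.
by have := sK i iK; rewrite inE.
Qed.

Lemma sub_Ineg_lt0 a K i : K \subset Ineg a -> i \in K -> coord_sum a K < 0.
Proof.
move=> /fintype.subsetP sK iK; rewrite /coord_sum (bigD1 i) //= ltr_wnDr //.
  by apply: sumr_le0 => j /andP[/sK + _]; rewrite inE => /ltW.
by have := sK i iK; rewrite inE.
Qed.

Lemma coord_sum_nonempty_proper a K : H a -> coord_sum a K != 0 -> nonempty_proper K.
Proof.
move=> Ha aK; split => e; move: aK; rewrite e ?coord_sum_set0 ?eqxx //.
by rewrite [coord_sum _ _]Ha eqxx.
Qed.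

Lemma generic_neq0 a K : generic a -> nonempty_proper K -> coord_sum a K != 0.
Proof.
move=> [[e _] _ _] [/eqP K0 /eqP KT].
have : K \in (Spos a :|: Sneg a)%SET.
  by rewrite e !inE negb_or K0 KT finset.subsetT.
by rewrite !inE; case: ltgtP.
Qed.

(** Genericity rules out a tie between [X] and its complement in [Ipos a], so the weak inequality
    obtained from a point of a cell is as good as the strict one. *)
Lemma generic_gt_half a X : generic a -> X \subset Ipos a ->
  (X \in gt_half a (Ipos a)) = (coord_sum a (Ipos a) <= 2 * coord_sum a X).
Proof.
move=> [_ [e _] _] sX.
have : X \in (gt_half a (Ipos a) :|: lt_half a (Ipos a))%SET.
  by rewrite e inE.
rewrite !inE sX /= coord_sumDset //.
by case: ltgtP => // h _; apply/esym; first [lra | apply/negbTE; rewrite -ltNge; lra].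
Qed.

Lemma generic_lt_half a X : generic a -> X \subset Ineg a ->
  (X \in lt_half a (Ineg a)) = (2 * coord_sum a X <= coord_sum a (Ineg a)).
Proof.
move=> [_ _ [e _]] sX.
have : X \in (gt_half a (Ineg a) :|: lt_half a (Ineg a))%SET.
  by rewrite e inE.
rewrite !inE sX /= coord_sumDset //.
by case: ltgtP => // h _; apply/esym; first [lra | apply/negbTE; rewrite -ltNge; lra].
Qed.

(** Singletons are nonempty and proper when [2 <= d], so genericity forbids zero coordinates. *)
Lemma generic_IposC (hd : (2 <= d)%N) a : generic a -> (~: Ineg a)%SET = Ipos a.
Proof.
move=> ga; apply/setP => i; rewrite !inE -leNgt le_eqVlt eq_sym.
have /negbTE -> // : a 0 i != 0.
have := generic_neq0 a [set i]%SET ga; rewrite /coord_sum big_set1; apply.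
split=> [/eqP|/(congr1 (fun K : {set 'I_d} => #|K|))].
  by apply/negP/set0Pn; exists i; rewrite inE.
by rewrite cards1 cardsT card_ord => e; move: hd; rewrite -e.
Qed.

(** * The combinatorial criterion for a nonempty cell *)

(** The first four clauses make the bounds on [I :\: J] and [J :\: I] compatible with the bisector
    equation. The last two say when the total can still be 0 although no coordinate is unbounded
    above, respectively below. *)
Definition cell_cond a I J :=
  [/\ (I :\: J)%SET \subset Ipos a, (J :\: I)%SET \subset Ineg a,
      I \in Spos a & (~: J)%SET \in Spos a] /\
  ((I :&: J)%SET = finset.set0 ->
     I \in gt_half a (Ipos a) /\ J \in lt_half a (Ineg a)) /\
  ((I :|: J)%SET = [set: 'I_d]%SET ->
     (~: J)%SET \in gt_half a (Ipos a) /\ (~: I)%SET \in lt_half a (Ineg a)).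

Lemma spread_sum K (r : R) : 0 <= r -> (K = finset.set0 -> r = 0) ->
  exists2 c : R, 0 <= c & \sum_(i in K) c = r.
Proof.
move=> r0 K0; exists (r / #|K|%:R); first by rewrite divr_ge0.
rewrite sumr_const -[LHS]mulr_natr; have [/K0 ->|Kn0] := eqVneq K finset.set0.
  by rewrite !mul0r.
by rewrite divfK // pnatr_eq0 cards_eq0.
Qed.

(** A single factor for a whole block: scaling by [l] in the unit interval keeps each coordinate
    between 0 and that of [a]. *)
Lemma scale_fit (A u : R) : 0 <= u <= A ->
  exists2 l : R, 0 <= l <= 1 & l * A = u.
Proof.
move=> /andP[u0 uA]; have [A0|An0] := eqVneq A 0.
  by exists 0; rewrite ?lexx ?ler01 // mul0r; lra.
have A0 : 0 < A by rewrite lt_def An0 (le_trans u0).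
by exists (u / A); rewrite ?divfK // divr_ge0 ?(ltW A0) //= ler_pdivrMr // mul1r.
Qed.

(* [u] and [v] are the masses of the constructed point on [I :\: J] and of its
   opposite on [J :\: I]; any excess is absorbed by the unbounded
   coordinates in [I :&: J] or outside [I :|: J]. *)
Lemma cell_fill a I J (u v s : R) :
  (I :\: J)%SET \subset Ipos a -> (J :\: I)%SET \subset Ineg a ->
  0 <= u <= coord_sum a (I :\: J)%SET ->
  0 <= v <= - coord_sum a (J :\: I)%SET ->
  u + v = - coord_sum a J ->
  s = pos_sum a (I :&: J)%SET + u - v + neg_sum a (~: (I :|: J))%SET ->
  ((I :&: J)%SET = finset.set0 -> 0 <= s) ->
  ((I :|: J)%SET = [set: 'I_d]%SET -> s <= 0) ->
  exists x : 'rV[R]_d,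
    [/\ H x, (forall i, i \in I -> 0 <= x 0 i), (forall i, i \notin I -> x 0 i <= 0),
      (forall i, i \in J -> a 0 i <= x 0 i) & (forall i, i \notin J -> x 0 i <= a 0 i)]
    /\ coord_sum x I = coord_sum x J - coord_sum a J.
Proof.
move=> /fintype.subsetP sA /fintype.subsetP sB uA vB uv sE s_ge0 s_le0.
have {sA}aA i : i \in I -> i \notin J -> 0 < a 0 i.
  by move=> iI iJ; have := sA i; rewrite !inE iI iJ; apply.
have {sB}aB i : i \notin I -> i \in J -> a 0 i < 0.
  by move=> iI iJ; have := sB i; rewrite !inE (negbTE iI) iJ; apply.
have [l l01 lu] := scale_fit _ _ uA; have [m m01 mv] := scale_fit _ _ vB.
(* Before correction the point has total [s]. A deficit is spread over [I :&: J] in shares [c], a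
   surplus is removed outside [I :|: J] in shares [e]; at most one of the two is nonzero. *)
have [||c c0 cs] := @spread_sum (I :&: J)%SET (Num.max (- s) 0).
- by rewrite le_max lexx orbT.
- by move=> /s_ge0 ?; rewrite max_r // oppr_le0.
have [||e e0 es] := @spread_sum (~: (I :|: J))%SET (Num.max s 0).
- by rewrite le_max lexx orbT.
- by move=> h; rewrite max_r // s_le0 // -[LHS]finset.setCK h finset.setC0.
pose x := \row_i (if i \in I then
    if i \in J then Num.max (a 0 i) 0 + c else l * a 0 i
  else if i \in J then m * a 0 i else Num.min (a 0 i) 0 - e).
have xK (f : 'I_d -> R) K : (forall i, i \in K -> x 0 i = f i) ->
    \sum_(i in K) x 0 i = \sum_(i in K) f i.
  by move=> h; apply: eq_bigr => i /h.
have x1 : \sum_(i in I :&: J) x 0 i = pos_sum a (I :&: J)%SET + Num.max (- s) 0.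
  rewrite -cs -big_split; apply: xK => i.
  by rewrite inE mxE => /andP[-> ->].
have x2 : \sum_(i in I :\: J) x 0 i = u.
  rewrite -lu mulr_sumr; apply: xK => i.
  by rewrite inE mxE => /andP[/negbTE -> ->].
have x3 : \sum_(i in J :\: I) x 0 i = - v.
  rewrite -mv mulrN opprK mulr_sumr; apply: xK => i.
  by rewrite inE mxE => /andP[/negbTE -> ->].
have x4 : \sum_(i in ~: (I :|: J)) x 0 i =
    neg_sum a (~: (I :|: J))%SET - Num.max s 0.
  rewrite -es -sumrB; apply: xK => i.
  by rewrite !inE mxE negb_or => /andP[/negbTE -> /negbTE ->].
have [xI xJ xT] := quad_split (x 0) I J.
have ms : Num.max (- s) 0 - Num.max s 0 = - s.
  by rewrite !maxEge oppr_ge0; case: (ltgtP s 0) => ?; lra.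
exists x; split; last by rewrite [LHS]xI [X in _ = X - _]xJ x1 x2 x3; lra.
split.
- by rewrite /H /= [LHS]xT x1 x2 x3 x4; lra.
- move=> i iI; rewrite mxE iI; case: (boolP (i \in J)) => iJ.
    by rewrite addr_ge0 // le_max lexx orbT.
  by have := aA i iI iJ; nra.
- move=> i iI; rewrite mxE (negbTE iI); case: (boolP (i \in J)) => iJ.
    by have := aB i iI iJ; nra.
  by rewrite subr_le0 (le_trans _ e0) // ge_min lexx orbT.
- move=> i iJ; rewrite mxE iJ; case: (boolP (i \in I)) => iI.
    by rewrite -[leLHS]addr0 lerD // le_max lexx.
  by have := aB i iI iJ; nra.
- move=> i iJ; rewrite mxE (negbTE iJ); case: (boolP (i \in I)) => iI.
    by have := aA i iI iJ; nra.
  by rewrite lerBlDr -[leLHS]addr0 lerD // ge_min lexx.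
Qed.

Lemma cell_condP (hd : (2 <= d)%N) a I J : H a -> generic a ->
  nonempty_proper I -> nonempty_proper J ->
  (bis_cell I J a !=set0)%classic <-> cell_cond a I J.
Proof.
move=> Ha ga nI nJ; rewrite bis_cellP //.
have [aI aJ aT] := quad_split (a 0) I J.
have [_ _ pT] := quad_split (fun i => Num.max (a 0 i) 0) I J.
have [_ _ nT] := quad_split (fun i => Num.min (a 0 i) 0) I J.
rewrite pos_sumT in pT; rewrite neg_sumT // in nT.
rewrite [LHS]Ha in aT; rewrite -!/(coord_sum a _) in aI aJ aT.
have p0 K : 0 <= pos_sum a K by apply: sumr_ge0 => i _; rewrite le_max lexx orbT.
have n0 K : neg_sum a K <= 0 by apply: sumr_le0 => i _; rewrite ge_min lexx orbT.
have hI := coord_sum_Ineg a Ha.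
have ID : (I :&: J)%SET = finset.set0 -> (I :\: J)%SET = I /\ (J :\: I)%SET = J.
  move=> e; split; first by rewrite -[RHS](finset.setID I J) e finset.set0U.
  by rewrite -[RHS](finset.setID J I) finset.setIC e finset.set0U.
have UD : (I :|: J)%SET = [set: 'I_d]%SET ->
    [/\ (I :\: J)%SET = (~: J)%SET, (J :\: I)%SET = (~: I)%SET &
        (~: (I :|: J))%SET = finset.set0].
  move=> /setP e; split; apply/setP => i; have := e i; rewrite !inE.
  - by case: (i \in I); case: (i \in J).
  - by case: (i \in I); case: (i \in J).
  - by move=> ->.
split.
  move=> [x [[Hx xI xC xJ xD] e]].
  have [yI yJ yT] := quad_split (x 0) I J.
  rewrite -!/(coord_sum x _) in yI yJ yT.
  rewrite [LHS]Hx in yT.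
  have u0 : 0 <= coord_sum x (I :\: J)%SET.
    by apply: sumr_ge0 => i; rewrite inE => /andP[_ /xI].
  have uA : coord_sum x (I :\: J)%SET <= coord_sum a (I :\: J)%SET.
    by apply: ler_sum => i; rewrite inE => /andP[/xD].
  have v0 : coord_sum x (J :\: I)%SET <= 0.
    by apply: sumr_le0 => i; rewrite inE => /andP[/xC].
  have vB : coord_sum a (J :\: I)%SET <= coord_sum x (J :\: I)%SET.
    by apply: ler_sum => i; rewrite inE => /andP[_ /xJ].
  have pp : pos_sum a (I :&: J)%SET <= coord_sum x (I :&: J)%SET.
    by apply: ler_sum => i; rewrite inE => /andP[/xI ? /xJ ?]; rewrite ge_max; apply/andP.
  have qq : coord_sum x (~: (I :|: J))%SET <= neg_sum a (~: (I :|: J))%SET.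
    apply: ler_sum => i; rewrite !inE negb_or => /andP[/xC ? /xD ?].
    by rewrite le_min; apply/andP.
  have sA : (I :\: J)%SET \subset Ipos a.
    apply/fintype.subsetP => i; rewrite inE => /andP[/xD h1 /xI h2].
    rewrite -(generic_IposC hd) // !inE -leNgt; exact: le_trans h2 h1.
  have sB : (J :\: I)%SET \subset Ineg a.
    apply/fintype.subsetP => i; rewrite inE => /andP[/xC h1 /xJ h2].
    rewrite -[_ \in _]negbK -finset.in_setC (generic_IposC hd) // !inE -leNgt.
    exact: le_trans h2 h1.
  have [pA nA] := sub_Ipos_sum sA; have [pB nB] := sub_Ineg_sum sB.
  have gI := generic_neq0 a I ga nI; have gJ := generic_neq0 a J ga nJ.
  split.
    (* The bisector equation says that the mass of [x] on [I :\: J] minus that on [J :\: I] is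
       [- coord_sum a J]. The block bounds then give [coord_sum a J <= 0 <= coord_sum a I], and
       genericity makes both strict. *)
    split=> //; rewrite inE ?coord_sumC // lt_def ?oppr_eq0 ?gI ?gJ /=; lra.
  split.
    move=> IJ0; have [IE JE] := ID IJ0.
    rewrite IJ0 !big_set0 ?coord_sum_set0 in pT nT aI aJ aT yI yJ yT pp.
    rewrite IE JE in sA sB pA nA pB nB pT nT aT yT u0 uA v0 vB.
    rewrite generic_gt_half // generic_lt_half //.
    split; lra.
  move=> IJT; have [IE JE UE] := UD IJT.
  rewrite UE !big_set0 ?coord_sum_set0 in pT nT aT yT qq.
  rewrite IE JE in sA sB pA nA pB nB pT nT aI aJ aT yI yJ yT u0 uA v0 vB.
  rewrite generic_gt_half // generic_lt_half //.
  split; lra.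
move=> [[sA sB gI gJ] [c1 c2]].
rewrite inE in gI; rewrite inE coord_sumC // in gJ.
have [pA nA] := sub_Ipos_sum sA; have [pB nB] := sub_Ineg_sum sB.
have A0 : 0 <= coord_sum a (I :\: J)%SET by rewrite -pA.
have B0 : coord_sum a (J :\: I)%SET <= 0 by rewrite -nB.
have n4 := n0 (~: (I :|: J))%SET; have p1 := p0 (I :&: J)%SET.
have [IJ0|/eqP IJn0] := eqVneq (I :&: J)%SET finset.set0.
  have [IE JE] := ID IJ0; have [g l] := c1 IJ0.
  have [sI sJ] : I \subset Ipos a /\ J \subset Ineg a by rewrite -{1}IE -{2}JE.
  rewrite generic_gt_half // in g; rewrite generic_lt_half // in l.
  (* The masses solve [u + v = m] and [u - v = c], so that [s = 0]. Here [m + c] is the positive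
     mass of [a], so the half-family conditions amount to [u <= coord_sum a I] and [0 <= v]. *)
  pose c := - neg_sum a (~: (I :|: J))%SET; pose m := - coord_sum a J.
  apply: (@cell_fill _ _ _ ((m + c) / 2) ((m - c) / 2) 0) => //;
    rewrite ?IE ?JE IJ0 !big_set0 ?coord_sum_set0 in pA nA pB nB pT nT aT A0 B0 *.
  - by apply/andP; split; rewrite /m /c; lra.
  - by apply/andP; split; rewrite /m /c; lra.
  - by rewrite /m; lra.
  - by rewrite /m /c; lra.
have [IJT|/eqP IJnT] := eqVneq (I :|: J)%SET [set: 'I_d]%SET.
  have [IE JE UE] := UD IJT; have [g l] := c2 IJT.
  have [sI sJ] : (~: J)%SET \subset Ipos a /\ (~: I)%SET \subset Ineg a.
    by rewrite -IE -JE.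
  rewrite generic_gt_half // in g; rewrite generic_lt_half // in l.
  (* The mirror case: now [v - u = c] gives [s = 0]. *)
  pose c := pos_sum a (I :&: J)%SET; pose m := - coord_sum a J.
  apply: (@cell_fill _ _ _ ((m - c) / 2) ((m + c) / 2) 0) => //;
    rewrite ?IE ?JE UE !big_set0 ?coord_sum_set0 in pA nA pB nB pT nT aT A0 B0 aI aJ *.
  - by apply/andP; split; rewrite /m /c; lra.
  - by apply/andP; split; rewrite /m /c; lra.
  - by rewrite /m; lra.
  - by rewrite /m /c; lra.
pose A := coord_sum a (I :\: J)%SET; pose m := - coord_sum a J.
(* Both unbounded blocks are present, so [s] is free and only [u + v = m] matters: [I :\: J] takes
   as much mass as it can hold, and [0 < coord_sum a I] lets [J :\: I] hold the rest. *)
pose u := Num.min A m.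
have [u1 u2 u3] : [/\ u <= A, u <= m & u = A \/ u = m].
  by rewrite /u; case: (leP A m) => h; split; rewrite ?(ltW h) //; auto.
apply: (@cell_fill _ _ _ u (m - u) _ sA sB _ _ _ erefl) => //.
- by apply/andP; split=> //; case: u3 => ->; rewrite /m /A //; lra.
- by apply/andP; split; [lra | case: u3 => ->; rewrite /m /A; lra].
- by rewrite /m; lra.
Qed.

(** The natural partner is [Ineg a]. When exactly one of the two half-family clauses would apply to
    it, one index is added or removed to make that clause vacuous. *)
Lemma cell_exists (hd : (2 <= d)%N) a I : H a -> generic a -> I \in Spos a ->
  exists J, cell_cond a I J.
Proof.
move=> Ha ga aI; have CI := generic_IposC hd a ga.
have mem_IposN i : (i \in Ipos a) = (i \notin Ineg a).
  by rewrite -CI inE.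
(* A common member [i] and a common non-member [j] make both half-family clauses vacuous. *)
have easy J i j : (I :\: J)%SET \subset Ipos a -> (J :\: I)%SET \subset Ineg a ->
    (~: J)%SET \in Spos a -> i \in I -> i \in J -> j \notin I -> j \notin J ->
    cell_cond a I J.
  move=> h1 h2 h3 iI iJ jI jJ; split=> //; split=> /setP.
    by move=> /(_ i); rewrite !inE iI iJ.
  by move=> /(_ j); rewrite !inE (negbTE jI) (negbTE jJ).
have [i0 i0P] : exists i, i \in Ipos a.
  apply/set0Pn; apply: contraTneq aI => P0; rewrite inE -leNgt pos_neg_sum.
  have -> : pos_sum a I = 0.
    apply: big1 => i _; rewrite max_r // leNgt.
    by have := finset.in_set0 i; rewrite -P0 inE => ->.
  by rewrite add0r; apply: sumr_le0 => i _; rewrite ge_min lexx orbT.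
have IC : (~: Ineg a)%SET \in Spos a.
  by rewrite inE CI (sub_Ipos_gt0 _ _ i0).
have [Isub|/fintype.subsetPn[k kI kP]] := boolP (I \subset Ipos a).
  have [Ieq|/fintype.subsetPn[j jP jI]] := boolP (Ipos a \subset I).
    have {Ieq Isub} -> : I = Ipos a by apply/eqP; rewrite finset.eqEsubset Isub.
    have hI := coord_sum_Ineg a Ha.
    have P0 := coord_sum_Ipos_ge0 a.
    (* Both clauses apply here, and hold since [Ipos a] and [Ineg a] carry their entire masses. *)
    exists (Ineg a); rewrite /cell_cond IC -CI finset.setCK CI.
    rewrite finset.subsetDl finset.subsetDl generic_gt_half // generic_lt_half //.
    rewrite inE (sub_Ipos_gt0 _ _ i0) //.
    by split=> //; split=> _; split; lra.
  have [i iI] : exists i, i \in I.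
    by apply/set0Pn; apply: contraTneq aI => ->; rewrite inE coord_sum_set0 ltxx.
  (* Adding [i] from [I] creates an intersection without enlarging [J :\: I]; the index [j] keeps
     the complement of [J] positive. *)
  exists (i |: Ineg a)%SET; apply: (easy _ i j) => //.
  - by apply: fintype.subset_trans Isub; exact: finset.subsetDl.
  - apply/fintype.subsetP => l; rewrite finset.in_setD finset.in_setU1.
    by move=> /andP[lI /orP[/eqP li|//]]; rewrite li iI in lI.
  - rewrite inE (sub_Ipos_gt0 _ _ j) //.
      by rewrite -CI finset.setCS finset.subsetUr.
    rewrite finset.in_setC finset.in_setU1 negb_or -mem_IposN jP andbT.
    by apply: contraNneq jI => ->.
  - by rewrite finset.in_setU1 eqxx.
  - rewrite finset.in_setU1 negb_or -mem_IposN jP andbT.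
    by apply: contraNneq jI => ->.
have kN : k \in Ineg a by rewrite -[_ \in _]negbK -mem_IposN.
have [PI|/fintype.subsetPn[j jP jI]] := boolP (Ipos a \subset I); last first.
  exists (Ineg a); apply: (easy _ k j) => //.
  - by rewrite finset.setDE CI finset.subsetIr.
  - exact: finset.subsetDl.
  - by rewrite -mem_IposN.
have [j jI] : exists j, j \notin I.
  have /set0Pn[j] : (~: I)%SET != finset.set0.
    apply: contraTneq aI => /(congr1 (@finset.setC _)).
    by rewrite finset.setCK finset.setC0 => ->; rewrite inE [coord_sum _ _]Ha ltxx.
  by rewrite inE; exists j.
have kj : k != j by apply: contraNneq jI => <-.
(* Dually, removing [j] outside [I] spoils the covering without enlarging [I :\: J]; the index [k]
   keeps the sum over [J] negative. *)
exists (Ineg a :\ j)%SET; apply: (easy _ k j) => //.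
- apply/fintype.subsetP => l; rewrite finset.in_setD finset.in_setD1 negb_and negbK.
  rewrite mem_IposN.
  by move=> /andP[/orP[/eqP ->|//]]; rewrite (negbTE jI).
- by apply: fintype.subset_trans (finset.subsetDl _ _) (finset.subsetDl _ _).
- rewrite inE coord_sumC // oppr_gt0 (sub_Ineg_lt0 _ _ k) //.
    exact: finset.subsetDl.
  by rewrite finset.in_setD1 kj.
- by rewrite finset.in_setD1 kj.
- by rewrite finset.in_setD1 eqxx.
Qed.

(** * Passing between [D] and the family of nonempty cells *)

Lemma Spos_mem_Ipos a i : (i \in Ipos a) = ([set i]%SET \in Spos a).
Proof. by rewrite !inE /coord_sum big_set1. Qed.

(** Singletons suffice. Together with [eq_Spos_Ineg] this makes [cell_cond] a function of [D a]. *)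
Lemma eq_Spos_Ipos a b : Spos a = Spos b -> Ipos a = Ipos b.
Proof. by move=> e; apply/setP => i; rewrite !Spos_mem_Ipos e. Qed.

Lemma eq_Spos_Ineg (hd : (2 <= d)%N) a b : generic a -> generic b ->
  Spos a = Spos b -> Ineg a = Ineg b.
Proof.
move=> ga gb e; apply: finset.setC_inj.
by rewrite !generic_IposC //; exact: eq_Spos_Ipos.
Qed.

Lemma Spos_nonempty_proper a K : H a -> K \in Spos a -> nonempty_proper K.
Proof.
by move=> Ha; rewrite inE => h; apply: (coord_sum_nonempty_proper a); rewrite ?gt_eqF.
Qed.

(** Lets the criterion be compared over all pairs, although [bis_equiv] only ranges over nonempty
    proper ones. *)
Lemma cell_cond_nonempty_proper a I J : H a -> cell_cond a I J ->
  nonempty_proper I /\ nonempty_proper J.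
Proof.
move=> Ha [[_ _ aI]]; rewrite inE coord_sumC // oppr_gt0 => aJ _.
split; first exact: Spos_nonempty_proper aI.
by apply: (coord_sum_nonempty_proper a); rewrite ?lt_eqF.
Qed.

Lemma bis_equivP (hd : (2 <= d)%N) a b : H a -> H b -> generic a -> generic b ->
  bis_equiv a b <-> forall I J, cell_cond a I J <-> cell_cond b I J.
Proof.
move=> Ha Hb ga gb; split=> h I J.
  split=> c.
    have [nI nJ] := cell_cond_nonempty_proper a I J Ha c.
    by apply/cell_condP/h/cell_condP.
  have [nI nJ] := cell_cond_nonempty_proper b I J Hb c.
  by apply/cell_condP/h/cell_condP.
by move=> nI nJ; rewrite !cell_condP.
Qed.

Lemma cell_cond_Spos (hd : (2 <= d)%N) a b : H a -> generic a ->
  (forall I J, cell_cond a I J -> cell_cond b I J) -> Spos a \subset Spos b.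
Proof.
move=> Ha ga h; apply/fintype.subsetP => I /(cell_exists hd a I Ha ga)[J /h].
by case; case.
Qed.

(** If [X] and [Y] also cover all indices, they are complementary, and the covering clause repeats
    the two hypotheses. *)
Lemma gt_lt_half_cell (hd : (2 <= d)%N) a X Y : H a -> generic a ->
  X \in gt_half a (Ipos a) -> Y \in lt_half a (Ineg a) ->
  (X :&: Y)%SET = finset.set0 /\ cell_cond a X Y.
Proof.
move=> Ha ga gX lY; have CI := generic_IposC hd a ga.
have hI := coord_sum_Ineg a Ha; have P0 := coord_sum_Ipos_ge0 a.
have [sX aX] : X \subset Ipos a /\ 0 < coord_sum a X.
  by move: gX; rewrite inE => /andP[sX]; rewrite coord_sumDset // => ?; split=> //; lra.
have [sY aY] : Y \subset Ineg a /\ coord_sum a Y < 0.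
  by move: lY; rewrite inE => /andP[sY]; rewrite coord_sumDset // => ?; split=> //; lra.
have XY : (X :&: Y)%SET = finset.set0.
  apply/setP => i; rewrite finset.in_setI finset.in_set0; apply/negP.
  move=> /andP[/(fintype.subsetP sX)].
  by rewrite -CI finset.in_setC => /negP iN /(fintype.subsetP sY).
split=> //; split.
  split; rewrite ?inE ?coord_sumC ?oppr_gt0 //.
    exact: fintype.subset_trans (finset.subsetDl _ _) sX.
  exact: fintype.subset_trans (finset.subsetDl _ _) sY.
split=> // XYT; have YC : (~: Y)%SET = X.
  apply/setP => i; move/setP: XY => /(_ i); move/setP: XYT => /(_ i); rewrite !inE.
  by case: (i \in X); case: (i \in Y).
by rewrite -YC finset.setCK YC.
Qed.

(** [Ipos a] and [Ineg a] lie in their own half-families, so each serves as a partner for testing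
    the other family. Disjointness of the pair does not depend on the vector, so it triggers the
    corresponding clause for [b]. *)
Lemma cell_cond_halves (hd : (2 <= d)%N) a b : H a -> generic a ->
  (forall I J, cell_cond a I J -> cell_cond b I J) ->
  gt_half a (Ipos a) \subset gt_half b (Ipos b) /\
  lt_half a (Ineg a) \subset lt_half b (Ineg b).
Proof.
move=> Ha ga h.
have hI := coord_sum_Ineg a Ha; have P0 := coord_sum_Ipos_ge0 a.
have gP : Ipos a \in gt_half a (Ipos a) by rewrite generic_gt_half //; lra.
have lN : Ineg a \in lt_half a (Ineg a) by rewrite generic_lt_half //; lra.
split; apply/fintype.subsetP => X hX.
  have [XN /h[_ [c _]]] := gt_lt_half_cell hd a _ _ Ha ga hX lN.
  by have [] := c XN.
have [XP /h[_ [c _]]] := gt_lt_half_cell hd a _ _ Ha ga gP hX.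
by have [] := c XP.
Qed.

End Cells.

Theorem theorem7p2 (R : realType) (d : nat) (hd : (2 <= d)%N)
    (a b : 'rV[R]_d) (Ha : H a) (Hb : H b)
    (ga : generic a) (gb : generic b) :
  bis_equiv a b <-> D a = D b.
Proof.
rewrite bis_equivP //; split=> [h|[eS eg el] I J]; last first.
  by rewrite /cell_cond eS eg el (eq_Spos_Ipos a b) // (eq_Spos_Ineg hd a b).
have eS : Spos a = Spos b.
  apply/eqP; rewrite finset.eqEsubset.
  by apply/andP; split; apply: cell_cond_Spos => // I J /h.
have [g1 l1] := cell_cond_halves hd a b Ha ga (fun I J => proj1 (h I J)).
have [g2 l2] := cell_cond_halves hd b a Hb gb
  (fun I J => proj2 (h I J)).
by rewrite /D eS; congr (_, _, _); apply/eqP; rewrite finset.eqEsubset ?g1 ?l1.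
Qed.
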